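(* Let $\kappa$ be an inaccessible cardinal. The following are equivalent: (1) $\kappa$ is supercompact. (2) For every regular cardinal $\mu \geq \kappa$, $\mathrm{LSCP}(P_\kappa\mu, \kappa\text{-cofinally})$ holds.
   Context: A cardinal $\kappa$ is $\lambda$-supercompact if there is a fine and normal measure on $P_\kappa\lambda$, and supercompact if it is $\lambda$-supercompact for all $\lambda\ge\kappa$. For a cardinal $\rho$ (not necessarily regular) and a set $X$, $P_\rho X$ is the set of all subsets of $X$ of size $<\rho$. A set $E\subseteq P_\rho X$ is a club if for every $x \in P_\rho X$ there is $y \in E$ with $x \subseteq y$, and $E$ is closed under unions of increasing sequences of length $<\operatorname{cf} \rho$. ''For club many $x$'' means for all $x$ in some club. A $P_\kappa\mu$-tree is a function $\mathcal{T} = \langle \mathcal{T}_x \mid x \in P_\kappa \mu\rangle$ such that: for every $x\in P_\kappa \mu$, $\mathcal{T}_x \subseteq {}^x 2$ is non-empty; for $x \subseteq y \in P_\kappa \mu$ and $\eta \in \mathcal{T}_y$, $\eta \restriction x \in \mathcal{T}_x$; and $|\mathcal{T}_x| < \kappa$ for every $x\in P_\kappa \mu$. A (cofinal) branch through $\mathcal{T}$ is a function $b \colon \mu\to 2$ such that $b\restriction x \in \mathcal{T}_x$ for all $x\in P_\kappa\mu$. A set $L$ is a ladder system on a $P_\kappa\mu$-tree $\mathcal T$ if: (1) $L \subseteq \bigcup_{x\in P_\kappa\mu} \mathcal T_x$; (2) for club many $x\in P_\kappa\mu$, $L \cap \mathcal T_x \neq \emptyset$; (3) if $\eta \in L \cap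 \mathcal T_x$ and $\operatorname{cf} (|x \cap \kappa|) > \omega$ then there is a club $E_\eta \subseteq P_{|x \cap \kappa|} x$ such that $\{\eta \restriction y \mid y \in E_\eta\} \subseteq L$. A cofinal branch $b$ meets $L$ $\kappa$-cofinally if for every $x \in P_\kappa\mu$ there is $z \supseteq x$ ($z\in P_\kappa\mu$) such that $b\restriction z \in L$. $\mathrm{LSCP}(P_\kappa\mu,\kappa\text{-cofinally})$ says: for every $P_\kappa \mu$-tree $\mathcal T$ and every ladder system $L$ on $\mathcal T$ there is a cofinal branch of $\mathcal{T}$ that meets $L$ $\kappa$-cofinally. *)

(* Defs.v *)
From HB Require Import structures.
From mathcomp Require Import all_boot all_order generic_quotient.
From mathcomp Require Import boolp classical_sets functions cardinality filter.

Set Implicit Arguments.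
Unset Strict Implicit.
Unset Printing Implicit Defensive.

Import Order.TTheory.

Local Open Scope classical_set_scope.
Local Open Scope card_scope.
Local Open Scope order_scope.
Local Open Scope quotient_scope.

(** Ordinals are the ranks of well-founded trees with small (i.e. [Type]-indexed)
    branching: [Sup f] has rank sup_a (rank (f a) + 1).  A set in the sense of
    ZFC corresponds to a small type, and [Ord] is the class of all ordinals.
    MathComp's [set A] lives in one fixed universe above that of small types;
    the small power set of a small type [A] is [A -> Prop]. *)

Inductive tree : Type := Sup (A : Type) (f : A -> tree).

HB.instance Definition _ := gen_eqMixin tree.
HB.instance Definition _ := gen_choiceMixin tree.

Fixpoint rank_le (s t : tree) : Prop :=
  match s, t with Sup A f, Sup B g => forall a, exists b, rank_le (f a) (g b) end.

Lemma rank_le_refl s : rank_le s s.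
Proof. by elim: s => A f IH /= a; exists a; apply: IH. Qed.

Lemma rank_le_trans s t u : rank_le s t -> rank_le t u -> rank_le s u.
Proof.
elim: s t u => A f IH [B g] [D h] /= st tu a.
have [b fg] := st a; have [d gh] := tu b.
by exists d; apply: IH gh.
Qed.

Lemma rank_nle A (f : A -> tree) t :
  ~ rank_le (Sup f) t -> exists a, rank_le t (f a).
Proof.
elim: t A f => B g IH A f /= /existsNP[a /forallNP nfg].
exists a; case: (f a) nfg => C h nhg b.
exact: IH (nhg b).
Qed.

Lemma rank_le_sub A (f : A -> tree) a : rank_le (f a) (Sup f).
Proof.
suff H t : forall B (g : B -> tree) b, t = g b -> rank_le t (Sup g) by exact: H.
elim: t => B g IH C h c ghc b /=.
by exists c; rewrite -ghc; apply: (IH b).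
Qed.

Lemma rank_le_total s t : rank_le s t \/ rank_le t s.
Proof.
have [|] := pselect (rank_le s t); first by left.
case: s => A f /rank_nle[a tfa]; right.
exact: rank_le_trans tfa (rank_le_sub _ _).
Qed.

Definition rank_eq (s t : tree) : bool := `[< rank_le s t /\ rank_le t s >].

Lemma rank_eq_refl : reflexive rank_eq.
Proof. by move=> s; apply/asboolP; split; apply: rank_le_refl. Qed.

Lemma rank_eq_sym : symmetric rank_eq.
Proof. by move=> s t; apply/asboolP/asboolP => -[]. Qed.

Lemma rank_eq_trans : transitive rank_eq.
Proof.
move=> t s u /asboolP[st ts] /asboolP[tu ut].
by apply/asboolP; split; [apply: rank_le_trans tu | apply: rank_le_trans ts].
Qed.

Canonical rank_eq_equiv := EquivRel rank_eq rank_eq_refl rank_eq_sym rank_eq_trans.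

Definition Ord := {eq_quot rank_eq}.

HB.instance Definition _ := Choice.on Ord.
HB.instance Definition _ := EqQuotient.on Ord.
HB.instance Definition _ := isPointed.Build Ord (\pi_Ord (Sup (of_void tree))).

Definition ord_le (a b : Ord) : bool := `[< rank_le (repr a) (repr b) >].

Lemma ord_le_anti : antisymmetric ord_le.
Proof.
move=> a b /andP[/asboolP ab /asboolP ba].
rewrite -(reprK a) -(reprK b); apply/eqmodP.
exact/asboolP.
Qed.

Lemma ord_le_trans : transitive ord_le.
Proof.
by move=> b a c /asboolP ab /asboolP bc; apply/asboolP; apply: rank_le_trans bc.
Qed.

Lemma ord_le_total : total ord_le.
Proof.
move=> a b; apply/orP.
by case: (rank_le_total (repr a) (repr b)) => h; [left | right]; apply/asboolP.
Qed.

Fact ord_display : Order.disp_t.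
Proof. exact: Order.Disp tt tt. Qed.

HB.instance Definition _ := Order.Le_isPOrder.Build ord_display Ord
  (fun a => introT (asboolP _) (rank_le_refl (repr a))) ord_le_anti ord_le_trans.
HB.instance Definition _ := Order.POrder_isTotal.Build ord_display Ord
  ord_le_total.


Lemma ord_lt_wf : well_founded (fun a b : Ord => a < b).
Proof.
suff H t : forall a : Ord, rank_le (repr a) t -> Acc (fun a b : Ord => a < b) a.
  by move=> a; apply: H (rank_le_refl _).
elim: t => B g IH a a_le; constructor => b.
rewrite ltNge => /asboolP ab.
move: a_le ab; case: (repr a) => A f fg /rank_nle[c bfc].
have [d cd] := fg c.
by apply: (IH d); apply: rank_le_trans cd.
Qed.

Definition least (A : set Ord) : Ord :=
  xget point [set a | A a /\ forall b, A b -> a <= b].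

Lemma leastP (A : set Ord) :
  A !=set0 -> A (least A) /\ forall b, A b -> least A <= b.
Proof.
move=> [a Aa]; rewrite /least; case: xgetP => // nmin.
exfalso; move: Aa; elim: (ord_lt_wf a) => {}a _ IH Aa.
case: (nmin a); split=> // b Ab; rewrite leNgt; apply/negP => ba.
exact: IH b ba Ab.
Qed.

(** The von Neumann ordinal [a], as a set of ordinals. *)
Definition seg (a : Ord) : set Ord := [set b | b < a].

(** [least] is total with a junk value on the empty set, so [cardinality A]
    means |A| only for sets [A] of small size, e.g. bounded sets of ordinals. *)
Definition cardinality T (A : set T) : Ord := least [set a | seg a #= A].

Definition is_cardinal (k : Ord) : Prop := cardinality (seg k) = k.

(** |A| < rho; unlike [cardinality A < rho], correct for arbitrary [A]. *)
Definition size_lt T (A : set T) (rho : Ord) : Prop :=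
  exists2 a, a < rho & seg a #= A.

Definition omega : Ord := least [set a | infinite_set (seg a)].

Definition cof (a : Ord) : Ord :=
  least [set b | exists2 f : Ord -> Ord, (forall d, d < b -> f d < a) &
                   forall c, c < a -> exists2 d, d < b & c <= f d].

Definition regular_cardinal (k : Ord) : Prop :=
  [/\ is_cardinal k, omega <= k & cof k = k].

Definition strong_limit (k : Ord) : Prop :=
  forall a, a < k -> size_lt [set A : set Ord | A `<=` seg a] k.

Definition inaccessible (k : Ord) : Prop :=
  [/\ regular_cardinal k, omega < k & strong_limit k].

Definition Psub (rho : Ord) (X : set Ord) : set (set Ord) :=
  [set x | x `<=` X /\ size_lt x rho].

(** A measure on P_kappa lambda is given as an ultrafilter on the ambient type
    [set Ord] that contains P_kappa lambda. *)
Definition is_measure (kappa lambda : Ord) (U : set (set (set Ord))) : Prop :=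
  [/\ UltraFilter U,
      U (Psub kappa (seg lambda)),
      (forall x, ~ U [set x]) &
      (forall a (A : Ord -> set (set Ord)), a < kappa ->
         (forall b, b < a -> U (A b)) ->
         U [set x | forall b, b < a -> A b x])].

Definition is_fine (lambda : Ord) (U : set (set (set Ord))) : Prop :=
  forall a, a < lambda -> U [set x | x a].

Definition is_normal (kappa lambda : Ord) (U : set (set (set Ord))) : Prop :=
  forall f : set Ord -> Ord,
    (forall x, Psub kappa (seg lambda) x -> f x < lambda) ->
    U [set x | x (f x)] ->
    exists2 a, a < lambda & U [set x | f x = a].

Definition lambda_supercompact (kappa lambda : Ord) : Prop :=
  exists U, [/\ is_measure kappa lambda U, is_fine lambda U & is_normal kappa lambda U].

Definition supercompact (kappa : Ord) : Prop :=
  forall lambda, is_cardinal lambda -> kappa <= lambda ->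
    lambda_supercompact kappa lambda.

(** Sequences in the closure clause are nonempty: a club need not contain the
    empty set. *)
Definition club (rho : Ord) (X : set Ord) (E : set (set Ord)) : Prop :=
  [/\ E `<=` Psub rho X,
      (forall x, Psub rho X x -> exists2 y, E y & x `<=` y) &
      (forall a (s : Ord -> set Ord), seg a !=set0 -> a < cof rho ->
         (forall b, b < a -> E (s b)) ->
         (forall b c, b <= c -> c < a -> s b `<=` s c) ->
         E (\bigcup_(b in seg a) s b))].

(** Partial functions from the ordinals to 2, [None] meaning undefined. *)
Definition pfun2 := Ord -> option bool.

Definition dom (f : pfun2) : set Ord := [set a | f a <> None].

Definition restr (f : pfun2) (x : set Ord) : pfun2 := patch (fun=> None) x f.

(** The values of a tree outside P_kappa mu are irrelevant. *)
Definition Ptree (kappa mu : Ord) (T : set Ord -> set pfun2) : Prop :=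
  [/\ (forall x, Psub kappa (seg mu) x ->
         T x !=set0 /\ forall f, T x f -> dom f = x),
      (forall x y f, Psub kappa (seg mu) x -> Psub kappa (seg mu) y ->
         x `<=` y -> T y f -> T x (restr f x)) &
      (forall x, Psub kappa (seg mu) x -> size_lt (T x) kappa)].

Definition branch (kappa mu : Ord) (T : set Ord -> set pfun2) (b : pfun2) :
    Prop :=
  dom b = seg mu /\ forall x, Psub kappa (seg mu) x -> T x (restr b x).

Definition ladder_system (kappa mu : Ord) (T : set Ord -> set pfun2)
    (L : set pfun2) : Prop :=
  [/\ L `<=` \bigcup_(x in Psub kappa (seg mu)) T x,
      (exists2 E, club kappa (seg mu) E & forall x, E x -> L `&` T x !=set0) &
      (forall x f, Psub kappa (seg mu) x -> (L `&` T x) f ->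
         omega < cof (cardinality (x `&` seg kappa)) ->
         exists2 E, club (cardinality (x `&` seg kappa)) x E &
                    [set restr f y | y in E] `<=` L)].

Definition meets_cofinally (kappa mu : Ord) (L : set pfun2) (b : pfun2) :
    Prop :=
  forall x, Psub kappa (seg mu) x ->
    exists z, [/\ Psub kappa (seg mu) z, x `<=` z & L (restr b z)].

Definition LSCP_cofinally (kappa mu : Ord) : Prop :=
  forall (T : set Ord -> set pfun2) (L : set pfun2),
    Ptree kappa mu T -> ladder_system kappa mu T L ->
    exists2 b, branch kappa mu T b & meets_cofinally kappa mu L b.

(* Main.v *)
Require Import Defs.
From mathcomp Require Import all_boot all_order.
From mathcomp Require Import generic_quotient boolp classical_sets functions.
From mathcomp Require Import cardinality filter wochoice.

Set Implicit Arguments.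
Unset Strict Implicit.
Unset Printing Implicit Defensive.

Import Order.TTheory.

Local Open Scope card_scope.
Local Open Scope order_scope.
Local Open Scope quotient_scope.
Local Open Scope classical_set_scope.

(** From supercompactness to branches: fix a fine normal measure U on
    P_kappa mu, a tree T and a ladder system L.  The measure contains every
    club ([ae_club]), so almost every x carries some eta_x in L and T_x.  Let b
    be the U-limit of the functions eta_x.  By completeness b agrees on any
    fixed small y with almost every eta_x, so b is a branch.  To meet L above
    y, note that for almost every x the set x /\ kappa is an initial segment of
    [kappa] whose cardinality exceeds the size of y and has uncountable
    cofinality ([ae_core_sub], [ae_core_gt], [ae_core_cof]); the ladder clause
    then provides z_x containing y, of size less than that cardinality, with
    the restriction of eta_x to z_x in L.  By normality z_x is almost
    everywhere one and the same set z ([ae_const_set]), and b restricted to z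
    is almost everywhere the restriction of eta_x, hence lies in L.

    From branches to supercompactness: given [lambda], choose a regular mu so
    large that ordinals below mu can code all subsets A_g of P_kappa lambda and
    all functions f_b from P_kappa lambda to [lambda].  The nodes of the tree at
    x are the restrictions to x of the functions sending g to the truth value
    of s in A_g, for s in P_kappa lambda containing x /\ lambda.  Since a
    restriction of a branch to fewer than [kappa] codes is realized by an
    actual s, the sets whose code is sent to 1 form a fine [kappa]-complete
    ultrafilter ([measure_witness]).  The ladder consists of the nodes that
    decide, for each function coded in their domain, a value it takes if it
    is regressive ([normal_at]).  The node of s = x /\ lambda does so as soon as
    x is closed under a binary function on codes, and the property passes to
    the subsets closed under a unary choice of witnesses, so this is a ladder
    system ([normal_ladder_system]); a branch meeting it cofinally gives a
    normal measure ([measure_normal]).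

    Both directions rest on elementary cardinal arithmetic for [Ord]: every
    small set is equinumerous to an initial segment ([small_card_seg]), the
    square of an infinite initial segment is equinumerous to it ([hessenberg]),
    so regular cardinals are unbounded and fewer than cof rho sets of size
    below rho have a union of size below rho ([size_lt_bigcup]). *)

(** * Comparing sizes of sets *)

Lemma card_le_surj T U (f : U -> T) (A : set T) (B : set U) :
  A `<=` f @` B -> A #<= B.
Proof.
by move=> /subset_card_le AB; exact: card_le_trans AB (card_image_le _ _).
Qed.

Lemma card_le_surjP (T : pointedType) U (A : set T) (B : set U) :
  A #<= B -> exists f : U -> T, A `<=` f @` B.
Proof. by move=> /pcard_surjP[f fS]; exists f. Qed.

Lemma card_le_injP T (U : pointedType) (A : set T) (B : set U) :
  A #<= B -> exists f : T -> U, (forall a, A a -> B (f a)) /\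
    (forall a b, A a -> A b -> f a = f b -> a = b).
Proof.
move=> /pcard_leP[f]; exists f; split; first by move=> a Aa; exact: funS.
by move=> a b Aa Ab; apply: inj; rewrite inE.
Qed.

Lemma card_le_inj T U (f : T -> U) (A : set T) (B : set U) :
  (forall a, A a -> B (f a)) ->
  (forall a b, A a -> A b -> f a = f b -> a = b) -> A #<= B.
Proof.
move=> fAB finj; apply: (@card_le_trans _ _ _ (f @` A)); last first.
  by apply: subset_card_le => _ [a Aa <-]; exact: fAB.
have : f @` A #= A by apply: inj_card_eq => a b /[!inE]; exact: finj.
by rewrite card_eq_le => /andP[].
Qed.

(** Cantor's diagonal argument, in the form in which A bounds its own power
    set. *)
Lemma cantor T (A : set T) U (B : set U) :
  [set X : set T | X `<=` A] #<= B -> B #<= A -> False.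
Proof.
move=> PB BA.
have /card_le_surjP[f fP] := card_le_trans PB BA.
pose D := [set a | A a /\ ~ f a a].
have [a Aa faD] : (f @` A) D by apply: fP => a [].
have [|nD] := pselect (D a); first by move=> /[dup] Da [_]; rewrite faD.
by apply: (nD); split=> //; rewrite faD.
Qed.

(** * Ordinals as ranks, and small sets *)

Lemma rank_pi t : rank_le (repr (\pi_Ord t)) t /\ rank_le t (repr (\pi_Ord t)).
Proof.
have /eqmodP : \pi_Ord (repr (\pi_Ord t)) = \pi_Ord t by rewrite reprK.
by move=> /asboolP.
Qed.

Lemma le_pi a t : (a <= \pi_Ord t) = `[< rank_le (repr a) t >].
Proof.
have [h1 h2] := rank_pi t.
by apply/asboolP/asboolP => h; exact: rank_le_trans h _.
Qed.

Lemma pi_le a t : (\pi_Ord t <= a) = `[< rank_le t (repr a) >].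
Proof.
have [h1 h2] := rank_pi t.
by apply/asboolP/asboolP => h; exact: rank_le_trans h.
Qed.

Lemma rank_Sup_nle A (f : A -> tree) a : ~ rank_le (Sup f) (f a).
Proof.
move: {2}(f a) (erefl (f a)) => t; elim: t A f a => B g IH A f a fa.
rewrite fa => /(_ a)[b]; rewrite fa.
exact: IH.
Qed.

Lemma lt_pi_Sup a (C : Type) (f : C -> tree) :
  a < \pi_Ord (Sup f) <-> exists c, a <= \pi_Ord (f c).
Proof.
rewrite ltNge pi_le; split=> [/asboolP/rank_nle[c h]|[c]].
  by exists c; rewrite le_pi; apply/asboolP.
rewrite le_pi => /asboolP h; apply/negP => /asboolP h'.
exact: rank_Sup_nle (rank_le_trans h' h).
Qed.

Lemma small_family_bounded (C : Type) (F : C -> Ord) :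
  exists b, forall c, F c < b.
Proof.
exists (\pi_Ord (Sup (fun c => repr (F c)))) => c.
by apply/lt_pi_Sup; exists c; rewrite reprK.
Qed.

(** Covered by a type of the universe over which the trees branch. These are
    the sets with a cardinality, since such a family of ordinals has an upper
    bound. *)
Definition small_set T (A : set T) : Prop :=
  exists (C : Type) (F : C -> T), A `<=` range F.

(** The proper subtrees of a tree, indexed by a type of the same universe;
    their ranks exhaust the ordinals below its rank. *)
Fixpoint below (t : tree) : Type :=
  match t with Sup A f => {a : A & option (below (f a))} end.

Fixpoint below_rank (t : tree) : below t -> tree :=
  match t with
  | Sup A f => fun s => let: existT a o := s in
      if o is Some n then below_rank n else f a
  end.

Lemma small_seg a : small_set (seg a).
Proof.
exists (below (repr a)), (fun n => \pi_Ord (below_rank n)) => b.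
rewrite /seg /= -{1}(reprK a); elim: (repr a) => A f IH /lt_pi_Sup[c].
rewrite le_eqVlt => /orP[/eqP ->|/IH[n _ <-]].
  by exists (existT _ c None).
by exists (existT _ c (Some n)).
Qed.

Lemma small_sub T (A B : set T) : A `<=` B -> small_set B -> small_set A.
Proof. by move=> AB [C [F BF]]; exists C, F; exact: subset_trans BF. Qed.

Lemma small_powerset T (A : set T) :
  small_set A -> small_set [set X : set T | X `<=` A].
Proof.
move=> [C [F AF]]; exists (C -> Prop), (fun P => [set F c | c in P]) => X XA.
exists (fun c => X (F c)) => //; apply/seteqP; split=> [_ [c Xc <-]//|t Xt].
by have /AF[c _ ct] := XA _ Xt; exists c => //=; rewrite ct.
Qed.

Lemma small_bound T (D : set T) (r : T -> Ord) :
  small_set D -> exists b, forall p, D p -> r p < b.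
Proof.
move=> [C [F DF]]; have [b Fb] := small_family_bounded (r \o F).
by exists b => p /DF[c _ <-]; exact: Fb.
Qed.

Lemma lt_least (A : set Ord) a : a < least A -> A !=set0 -> ~ A a.
Proof. by move=> + /leastP[_ lA] /lA; rewrite ltNge => /negbTE ->. Qed.

(** * Collapsing well-founded relations to ordinals *)

(** The Mostowski collapse of [D]: the rank [r p] is the least strict upper
    bound of the ranks of the predecessors of [p] in [D]. Smallness of [D]
    bounds these ranks, and transitivity of [R] makes every ordinal below [r
    p] the rank of a predecessor. *)
Lemma collapse T (R : T -> T -> Prop) (D : set T) :
  well_founded R -> (forall p q s, R p q -> R q s -> R p s) -> small_set D ->
  exists (r : T -> Ord) (h : Ord),
    [/\ forall p q, D q -> R q p -> r q < r p,
        forall p a, a < r p -> exists2 q, D q /\ R q p & r q = a,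
        forall p, D p -> r p < h &
        forall a, a < h -> exists2 p, D p & r p = a].
Proof.
move=> wfR Rtr Dsmall.
pose r := Fix wfR (fun=> Ord) (fun p rec =>
  least [set a | forall q (h : R q p), D q -> rec q h < a]).
have rE p : r p = least [set a | forall q, R q p -> D q -> r q < a].
  rewrite /r Fix_eq// => {}p f g fg; congr least.
  apply/seteqP; split=> a /= h q Rq Dq; first by rewrite -fg; exact: h.
  by rewrite fg; exact: h.
have bd : exists b, forall p, D p -> r p < b by exact: small_bound.
have ub p : [set a | forall q, R q p -> D q -> r q < a] !=set0.
  by have [b Db] := bd; exists b => q _; exact: Db.
have rlt p q : D q -> R q p -> r q < r p.
  by move=> Dq Rq; rewrite (rE p); apply: (leastP (ub p)).1.
have rdown p a : a < r p -> exists2 q, D q /\ R q p & r q = a.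
  elim: (wfR p) a => {}p _ IH a.
  rewrite rE => /lt_least/(_ (ub p))/existsNP[q /not_implyP[Rq /not_implyP[Dq]]].
  move=> /negP; rewrite -leNgt le_eqVlt => /orP[/eqP ->|]; first by exists q.
  move=> /(IH _ Rq)[s [Ds Rs] <-]; exists s => //; split=> //.
  exact: Rtr Rs Rq.
pose H := [set a | forall p, D p -> r p < a].
have H0 : H !=set0 by [].
exists r, (least H); split=> //; first exact: (leastP H0).1.
move=> a /lt_least/(_ H0)/existsNP[p /not_implyP[Dp]].
move=> /negP; rewrite -leNgt le_eqVlt => /orP[/eqP ->|]; first by exists p.
by move=> /rdown[q [Dq _] <-]; exists q.
Qed.

Lemma collapse_card T (R : T -> T -> Prop) (D : set T) (r : T -> Ord) h :
  (forall p q, D p -> D q -> p <> q -> R p q \/ R q p) ->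
  (forall p q, D q -> R q p -> r q < r p) ->
  (forall p, D p -> r p < h) ->
  (forall a, a < h -> exists2 p, D p & r p = a) -> seg h #= D.
Proof.
move=> Rtot rlt rh hr; rewrite card_eq_le; apply/andP; split.
  by apply: (card_le_surj (f := r)) => a /hr[p Dp <-]; exists p.
apply: (card_le_inj (f := r)) => // p q Dp Dq rpq.
apply: contrapT => /(Rtot _ _ Dp Dq)[/(rlt _ _ Dp)|/(rlt _ _ Dq)];
  by rewrite rpq ltxx.
Qed.

(** The well-ordering principle, recast from the existence of minima to well-
    foundedness of the strict order. *)
Lemma exists_wellorder T : exists R : T -> T -> Prop,
  [/\ well_founded R, (forall p q s, R p q -> R q s -> R p s) &
      forall p q, p <> q -> R p q \/ R q p].
Proof.
have [R Rwo] := well_ordering_principle {classic T}.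
have Rmin (A : set T) : A !=set0 -> exists2 z, A z & forall x, A x -> R z x.
  move=> [a Aa]; have [|z [[zA zmin] _]] := Rwo (fun x => `[< A x >]).
    by exists a; apply/asboolP.
  by exists z; [exact/asboolP | move=> x /asboolP/zmin].
have Ruq x y z : R x y -> R y x -> x = y.
  move=> xy yx.
  have [|w [_ wuq]] := Rwo (fun z => `[< z = x \/ z = y >]).
    by exists x; apply/asboolP; left.
  have Rxx u : R u u by have [|v -> /(_ u erefl)] := Rmin [set u]; first by exists u.
  transitivity w; [symmetry|]; apply: wuq; split; do ?[by apply/asboolP; auto];
  by move=> v /asboolP[->|->].
have Rtot x y : R x y \/ R y x.
  have [|z [->|->] h] := Rmin [set x; y]; first by exists x; left.
    by left; apply: h; right.
  by right; apply: h; left.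
have Rwf : well_founded (fun x y : T => R x y /\ x <> y).
  move=> x; apply: contrapT => nx.
  have [|z nz zmin] := Rmin [set x | ~ Acc (fun x y => R x y /\ x <> y) x].
    by exists x.
  apply: nz; constructor => y [yz ynz]; apply: contrapT => ny.
  by apply: ynz; apply: Ruq => //; apply: zmin.
exists (fun x y => R x y /\ x <> y); split=> //.
  move=> p q s [pq npq] [qs nqs]; split; last first.
    by move=> ps; apply: npq; apply: Ruq => //; rewrite ps.
  have [|z [[->|->]|->] h] := Rmin [set p; q; s]; first by exists p; left; left.
  - by apply: h; right.
  - by case: npq; apply: Ruq => //; apply: h; left; left.
  - by case: nqs; apply: Ruq => //; apply: h; left; right.
move=> p q npq; case: (Rtot p q) => h; [left|right]; split=> // e.
by apply: npq.
Qed.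

(** Collapse a well-ordering of the ambient type, restricted to [D]. *)
Lemma small_card_seg T (D : set T) : small_set D -> exists a, seg a #= D.
Proof.
move=> Ds; have [R [Rwf Rtr Rtot]] := exists_wellorder T.
have [r [h [h1 _ h3 h4]]] := collapse Rwf Rtr Ds.
by exists h; apply: (collapse_card (R := R) (r := r)) => // p q _ _ /Rtot.
Qed.

(** Collapsing a set of ordinals never raises an element, so the order type of
    a subset of [a] is at most [a]. *)
Lemma subset_seg_card (A : set Ord) a :
  A `<=` seg a -> exists2 b, b <= a & seg b #= A.
Proof.
move=> Aa.
have ltr (p q s : Ord) : p < q -> q < s -> p < s by exact: lt_trans.
have [r [h [h1 h2 h3 h4]]] := collapse ord_lt_wf ltr (small_sub Aa (small_seg a)).
have rle p : r p <= p.
  elim: (ord_lt_wf p) => {}p _ IH; rewrite leNgt; apply/negP => /h2[q [_ qp] rq].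
  by have := IH _ qp; rewrite rq leNgt qp.
exists h; last first.
  apply: (collapse_card (R := fun a b : Ord => a < b) (r := r)) => // p q _ _.
  by case: (ltgtP p q) => //; auto.
rewrite leNgt; apply/negP => /h4[p /Aa].
by rewrite /seg/= => pa rp; have := rle p; rewrite rp leNgt pa.
Qed.

Lemma card_le_seg T (A : set T) a :
  A #<= seg a -> exists2 b, b <= a & seg b #= A.
Proof.
move=> /card_le_injP[f [fA finj]].
have [|b ba bA] := @subset_seg_card (f @` A) a; first by move=> _ [x /fA fx <-].
exists b => //; apply: (card_eq_trans bA).
by apply: inj_card_eq => x y /[!inE]; exact: finj.
Qed.

Lemma subset_card_seg a b : a <= b -> seg a #<= seg b.
Proof. by move=> ab; apply: subset_card_le => c /lt_le_trans; exact. Qed.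

Lemma eq_card_le T U (A : set T) (B : set U) : A #= B -> A #<= B.
Proof. by rewrite card_eq_le => /andP[]. Qed.

Lemma size_ltP T (A : set T) rho :
  size_lt A rho <-> exists2 a, a < rho & A #<= seg a.
Proof.
split=> [[a ar aA]|[a ar /card_le_seg[b ba bA]]].
  by exists a => //; apply: eq_card_le; rewrite card_eq_sym.
by exists b => //; exact: le_lt_trans ba ar.
Qed.

Lemma size_lt_le T U (A : set T) (B : set U) rho :
  A #<= B -> size_lt B rho -> size_lt A rho.
Proof.
move=> AB /size_ltP[a ar Ba]; apply/size_ltP; exists a => //.
exact: card_le_trans Ba.
Qed.

Lemma cardinalityP T (A : set T) : small_set A -> seg (cardinality A) #= A.
Proof. by move=> /small_card_seg/leastP[]. Qed.

Lemma cardinality_le T (A : set T) a : A #<= seg a -> cardinality A <= a.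
Proof.
move=> /card_le_seg[b ba bA].
by apply: le_trans ba; apply: (leastP _).2 => //; exists b.
Qed.

Lemma cardinal_Nle k a : is_cardinal k -> a < k -> ~ (seg k #<= seg a).
Proof. by move=> kc ak /cardinality_le; rewrite kc leNgt ak. Qed.

Lemma cardinality_is_cardinal T (A : set T) :
  small_set A -> is_cardinal (cardinality A).
Proof.
move=> As; have Ac := cardinalityP As; apply/eqP; rewrite eq_le.
rewrite cardinality_le ?card_lexx//=; apply: cardinality_le.
rewrite card_eq_sym in Ac; apply: card_le_trans (eq_card_le Ac) _.
by have := cardinalityP (small_seg (cardinality A)); rewrite card_eq_sym => /eq_card_le.
Qed.

Lemma omega_ex : [set a | infinite_set (seg a)] !=set0.
Proof.
have [|a aN] := @small_card_seg _ [set: nat].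
  by exists nat, id => n _; exists n.
by exists a => /=; rewrite (eq_finite_set aN); exact: infinite_nat.
Qed.

Lemma seg_omega : infinite_set (seg omega).
Proof. exact: (leastP omega_ex).1. Qed.

Lemma infinite_seg a : infinite_set (seg a) <-> omega <= a.
Proof.
split=> [|oa]; first exact: (leastP omega_ex).2.
by apply: sub_infinite_set seg_omega => c /lt_le_trans; exact.
Qed.

Lemma finite_seg a : finite_set (seg a) <-> a < omega.
Proof.
rewrite ltNge; split=> [fa|/negP oa]; first by apply/negP => /infinite_seg; exact.
by apply: contrapT => /infinite_seg.
Qed.

Lemma finite_size_lt T (A : set T) rho :
  omega <= rho -> finite_set A -> size_lt A rho.
Proof.
move=> orho fA.
have [|b b1 bA] := @card_le_seg _ A omega.
  exact: card_le_trans (finite_set_countable fA) ((infiniteP _).1 seg_omega).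
by exists b => //; apply: lt_le_trans orho; apply/finite_seg; rewrite (eq_finite_set bA).
Qed.

(** Hilbert's hotel: shift a copy of the natural numbers inside [A] by one to
    make room for [x]. *)
Lemma infinite_set_add1 (T : pointedType) (A : set T) x : infinite_set A -> x |` A #<= A.
Proof.
move=> /infiniteP/card_le_injP[g [gA ginj]].
(* [f] sends [x] to the first point of the copy [g] of the natural numbers
   and the n-th point of the copy to the next one. *)
pose f y := if pselect (y = x) is left _ then g 0%N
  else if pselect (exists n, y = g n) is left h then g (sval (cid h)).+1 else y.
have fin y : A y -> A (f y).
  move=> Ay; rewrite /f; case: pselect => // _; first exact: gA.
  by case: pselect => // h; exact: gA.
apply: (card_le_inj (f := f)).
  move=> a [->|/fin//]; rewrite /f; case: pselect => // _; exact: gA.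
move=> a b _ _; rewrite /f.
case: (pselect (a = x)) => [->|na]; case: (pselect (b = x)) => [->//|nb].
- case: pselect => [h /ginj e|h e]; first by have := e I I.
  by case: h; exists 0%N.
- case: pselect => [h /ginj e|h e]; first by have := e I I.
  by case: h; exists 0%N.
- case: (pselect (exists n, a = g n)) => ha;
    case: (pselect (exists n, b = g n)) => hb //.
  + case: cid => n /= an; case: cid => m /= bm /ginj e.
    by have [e'] := e I I; rewrite an bm e'.
  + by case: cid => n /= an bE; case: hb; exists n.+1.
  + by case: cid => n /= an bE; case: ha; exists n.+1.
Qed.

(** * Squares and unions of infinite cardinals *)

Lemma card_le_setX T T' (U U' : pointedType) (A : set T) (A' : set T')
    (B : set U) (B' : set U') :
  A #<= B -> A' #<= B' -> A `*` A' #<= B `*` B'.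
Proof.
move=> /card_le_injP[f [fA finj]] /card_le_injP[g [gA ginj]].
apply: (card_le_inj (f := fun p => (f p.1, g p.2))).
  by move=> [a a'] [/= /fA Aa /gA Aa'].
by move=> [a a'] [b b'] [/= Aa Aa'] [/= Ab Ab'] [/finj -> // /ginj ->].
Qed.

Lemma seg_le_card i : omega <= i -> [set a | a <= i] #<= seg i.
Proof.
move=> /infinite_seg/infinite_set_add1-/(_ i); apply: card_le_trans.
apply: subset_card_le => a; rewrite /= le_eqVlt => /orP[/eqP ->|]; first by left.
by right.
Qed.

Lemma seg_le_finite i : i < omega -> finite_set [set a | a <= i].
Proof.
move=> /finite_seg fi; apply: sub_finite_set (_ : _ `<=` i |` seg i) _; last first.
  by rewrite finite_setU; split=> //; exact: finite_set1.
by move=> a; rewrite /= le_eqVlt => /orP[/eqP ->|]; [left|right].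
Qed.

Lemma infinite_cardinal_limit k i : is_cardinal k -> omega <= k -> i < k ->
  exists2 j, i < j & j < k.
Proof.
move=> kc ok ik; apply: contrapT => nj.
have kI : seg k `<=` [set a | a <= i].
  by move=> j jk; rewrite /= leNgt; apply/negP => ij; apply: nj; exists j.
have [oi|io] := leP omega i; last first.
  by have /infinite_seg := ok; apply; apply: sub_finite_set kI (seg_le_finite io).
apply: (cardinal_Nle kc ik).
exact: card_le_trans (subset_card_le kI) (seg_le_card oi).
Qed.

(** Goedel's well-ordering of pairs: by maximum, then lexicographically. Its
    proper initial segments are covered by squares of smaller initial segments
    of the ordinals. *)
Definition godel_lt (p q : Ord * Ord) : Prop :=
  let m (p : Ord * Ord) := Order.max p.1 p.2 in
  m p < m q \/ m p = m q /\ (p.1 < q.1 \/ p.1 = q.1 /\ p.2 < q.2).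

Lemma godel_lt_wf : well_founded godel_lt.
Proof.
move=> p; move: {2}(Order.max _ _) (erefl (Order.max p.1 p.2)) => m.
elim: (ord_lt_wf m) p => {}m _ IHm [a b].
elim: (ord_lt_wf a) b => {}a _ IHa b.
elim: (ord_lt_wf b) => {}b _ IHb mE; constructor => -[c d] [lt_m|[eq_m lt_cd]].
  by apply: (IHm _ _ (c, d) erefl); rewrite -mE; exact: lt_m.
have {eq_m}mE' : Order.max c d = m by rewrite -mE; exact: eq_m.
case: lt_cd => [ca|[ca db]]; first exact: (IHa c ca d mE').
have ca' : c = a by exact: ca.
by rewrite ca' in mE' *; exact: (IHb d db mE').
Qed.

Lemma godel_lt_trans p q s : godel_lt p q -> godel_lt q s -> godel_lt p s.
Proof.
case=> [pq|[pq H]] [qs|[qs K]].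
- by left; exact: lt_trans qs.
- by left; rewrite -qs.
- by left; rewrite pq.
right; rewrite pq; split=> //; case: H => [H|[H1 H2]]; case: K => [K|[K1 K2]].
- by left; exact: lt_trans K.
- by left; rewrite -K1.
- by left; rewrite H1.
by right; rewrite H1; split=> //; exact: lt_trans K2.
Qed.

Lemma godel_lt_total p q : p <> q -> godel_lt p q \/ godel_lt q p.
Proof.
case: p q => [a b] [c d] npq; rewrite /godel_lt /=.
case: (ltgtP (Order.max a b) (Order.max c d)) => [|| e]; try by [auto].
case: (ltgtP a c) => [|| e1]; try by auto.
case: (ltgtP b d) => [h|h|e2]; last by case: npq; rewrite e1 e2.
- by left; right; split=> //; right.
- by right; right; split=> //; right.
Qed.

(** If [a] is equinumerous to a smaller ordinal, use induction. Otherwise let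
    [h] be the order type of the Goedel ordering on the square of [a]. If [h]
    exceeded [a], then [a] would embed into the predecessors of a single pair,
    hence into the square of an ordinal smaller than [a], which by induction
    is finite or no larger than that ordinal. *)
Theorem hessenberg a : omega <= a -> seg a `*` seg a #<= seg a.
Proof.
elim: (ord_lt_wf a) => {}a _ IH oa.
have [[b ba ab]|nab] := pselect (exists2 b, b < a & seg a #<= seg b).
  have ob : omega <= b.
    by apply/infinite_seg => fb; move/infinite_seg: oa; apply; exact: card_le_finite ab fb.
  apply: card_le_trans (card_le_setX ab ab) _; apply: card_le_trans (IH _ ba ob) _.
  exact/subset_card_seg/ltW.
have Dsmall : small_set (seg a `*` seg a).
  have [C [F CF]] := small_seg a.
  exists (C * C)%type, (fun p => (F p.1, F p.2)) => -[b c] [/= /CF[x _ <-] /CF[y _ <-]].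
  by exists (x, y).
have [r [h [h1 h2 h3 h4]]] := collapse godel_lt_wf godel_lt_trans Dsmall.
have hD : seg h #= seg a `*` seg a.
  by apply: (collapse_card (R := godel_lt) (r := r)) => // p q _ _; exact: godel_lt_total.
have [ha|/h4[p [p1 p2] rp]] := leP h a.
  rewrite card_eq_sym in hD; apply: card_le_trans (eq_card_le hD) _.
  exact: subset_card_seg.
pose m := Order.max p.1 p.2.
have ma : m < a by rewrite /m gt_max; apply/andP.
have aI : seg a #<= [set b | b <= m] `*` [set b | b <= m].
  apply: (card_le_surj (f := r)) => b; rewrite -rp => /h2[q [_ qp] <-].
  exists q => //; have : Order.max q.1 q.2 <= m.
    by case: qp => [/ltW//|[-> _]].
  by rewrite ge_max => /andP[].
have [om|mo] := leP omega m; last first.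
  move/infinite_seg: oa => []; apply: card_le_finite aI _.
  by apply: finite_setX; exact: seg_le_finite.
case: nab; exists m => //; apply: card_le_trans aI _.
apply: card_le_trans (IH _ ma om).
by apply: card_le_setX; exact: seg_le_card.
Qed.

Lemma size_lt_setX T U (A : set T) (B : set U) rho :
  omega < rho -> size_lt A rho -> size_lt B rho -> size_lt (A `*` B) rho.
Proof.
move=> orho /size_ltP[a ar Aa] /size_ltP[b br Bb].
(* Hessenberg's theorem needs an infinite bound, hence the maximum with omega. *)
pose m := Order.max omega (Order.max a b).
apply/size_ltP; exists m; first by rewrite /m !gt_max orho ar.
have om : omega <= m by rewrite /m le_max lexx.
apply: card_le_trans (hessenberg om).
apply: card_le_setX; [apply: card_le_trans Aa _ | apply: card_le_trans Bb _];
  by apply: subset_card_seg; rewrite /m !le_max lexx ?orbT.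
Qed.

Lemma card_le_bigcup I (T : pointedType) U (J : set I) (F : I -> set T)
    (B : set U) :
  (forall i, J i -> F i #<= B) -> \bigcup_(i in J) F i #<= J `*` B.
Proof.
move=> FB; have : forall i, exists g : U -> T, J i -> F i `<=` g @` B.
  move=> i; have [/FB/card_le_surjP[g gS]|nJ] := pselect (J i); first by exists g.
  by exists (fun=> point).
move=> /choice[g gS]; apply: (card_le_surj (f := fun p => g p.1 p.2)).
by move=> t [i Ji /(gS i Ji)[b Bb <-]]; exists (i, b).
Qed.

Lemma cof_ex a : [set b | exists2 f : Ord -> Ord, (forall d, d < b -> f d < a) &
                   forall c, c < a -> exists2 d, d < b & c <= f d] a.
Proof. by exists id => // c ca; exists c. Qed.

Lemma cof_le a : cof a <= a.
Proof. by apply: (leastP _).2 (cof_ex a); exists a; exact: cof_ex. Qed.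

(** A family indexed by fewer than [cof rho] elements cannot be cofinal in
    [rho]. *)
Lemma cof_bound (I : pointedType) (J : set I) (f : I -> Ord) rho :
  size_lt J (cof rho) -> (forall i, J i -> f i < rho) ->
  exists2 c, c < rho & forall i, J i -> f i < c.
Proof.
move=> [a ac aJ] fJ; apply: contrapT => nc.
have [|e eJ] := @card_le_surjP _ _ J (seg a).
  by apply: eq_card_le; rewrite card_eq_sym.
have [|e' [e'J e'inj]] := @card_le_injP _ I (seg a) J; first exact: eq_card_le.
suff : cof rho <= a by rewrite leNgt ac.
apply: (leastP _).2; first by exists rho; exact: cof_ex.
pose g d := if `[< J (e d) >] then f (e d) else f (e' d).
exists g => [d da|c cr].
  by rewrite /g; case: asboolP => h; apply: fJ => //; exact: e'J.
apply: contrapT => nd; apply: nc; exists c => // i /[dup] Ji /eJ[d da di].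
rewrite ltNge; apply/negP => cf; apply: nd; exists d => //.
by rewrite /g di; case: asboolP.
Qed.

(** The sizes of the members have a common bound [m] below [rho], so the union
    embeds into [J] times [m]. *)
Lemma size_lt_bigcup (I T : pointedType) (J : set I) (F : I -> set T) rho :
  omega < rho -> size_lt J (cof rho) -> (forall i, J i -> size_lt (F i) rho) ->
  size_lt (\bigcup_(i in J) F i) rho.
Proof.
move=> orho Jc Fr.
have : forall i, exists c, J i -> c < rho /\ F i #<= seg c.
  move=> i; have [/Fr/size_ltP[c cr Fc]|nJ] := pselect (J i); first by exists c.
  by exists point.
move=> /choice[c cP].
have [m mr cm] := cof_bound Jc (fun i Ji => (cP i Ji).1).
apply: (@size_lt_le _ _ _ (J `*` seg m)).
  apply: card_le_bigcup => i Ji; apply: card_le_trans (cP i Ji).2 _.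
  by apply: subset_card_seg; exact/ltW/cm.
apply: size_lt_setX => //; last by exists m.
by case: Jc => a ac aJ; exists a => //; exact: lt_le_trans (cof_le _).
Qed.

Lemma size_lt_nat rho : omega < rho -> size_lt [set: nat] rho.
Proof.
move=> orho; apply/size_ltP; exists omega => //.
exact: (infiniteP _).1 seg_omega.
Qed.

Lemma size_lt_image T U (f : T -> U) (A : set T) rho :
  size_lt A rho -> size_lt (f @` A) rho.
Proof. exact/size_lt_le/card_image_le. Qed.

Lemma size_lt_sub T (A B : set T) rho :
  A `<=` B -> size_lt B rho -> size_lt A rho.
Proof. by move=> AB; exact/size_lt_le/subset_card_le. Qed.

(** The least ordinal that does not embed into [a'], the larger of omega and
    [a], is a regular cardinal: if its cofinality were smaller, it would be a
    union of at most [a'] sets of size at most [a'] and so embed into the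
    square of [a']. *)
Lemma regular_unbounded a : exists2 mu, regular_cardinal mu & a < mu.
Proof.
pose a' := Order.max omega a.
have oa : omega <= a' by rewrite /a' le_max lexx.
pose H := [set b | ~ (seg b #<= seg a')].
have H0 : H !=set0.
  have [b bP] := small_card_seg (small_powerset (small_seg a')).
  exists b => /= ba; apply: (@cantor _ (seg a') _ (seg a')); last exact: card_lexx.
  by rewrite card_eq_sym in bP; exact: card_le_trans (eq_card_le bP) ba.
set mu := least H; have [Hmu muH] := leastP H0.
have ltmu b : b < mu -> seg b #<= seg a'.
  by move=> /lt_least/(_ H0); rewrite /H/= => /contrapT.
have amu : a' < mu.
  by rewrite ltNge; apply/negP => /subset_card_seg.
have mucard : is_cardinal mu.
  apply/eqP; rewrite eq_le cardinality_le ?card_lexx//= leNgt; apply/negP => /ltmu.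
  apply/negP; apply: contra_notN Hmu; apply: card_le_trans.
  by apply: eq_card_le; rewrite card_eq_sym; exact/cardinalityP/small_seg.
exists mu; last by apply: le_lt_trans amu; rewrite /a' le_max lexx orbT.
split=> //; first exact/ltW/(le_lt_trans oa).
apply/eqP; rewrite eq_le cof_le leNgt; apply/negP => cmu.
have [|f fmu fcof] := (leastP (A := [set b |
  exists2 f : Ord -> Ord, (forall d, d < b -> f d < mu) &
                   forall c, c < mu -> exists2 d, d < b & c <= f d]) _).1.
  by exists mu; exact: cof_ex.
apply: Hmu; apply: card_le_trans (hessenberg oa).
apply: (@card_le_trans _ _ _ (\bigcup_(d in seg (cof mu)) [set c | c <= f d])).
  by apply: subset_card_le => c /fcof[d dc cf]; exists d.
apply: card_le_trans (card_le_bigcup (B := seg a') _) _; last first.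
  by apply: card_le_setX (card_lexx _); exact: ltmu.
move=> d /fmu fd; have [|j fj jmu] := infinite_cardinal_limit mucard _ fd.
  exact/ltW/(le_lt_trans oa).
apply: card_le_trans (ltmu _ jmu); apply: subset_card_le => c /= cf.
exact: le_lt_trans fj.
Qed.

Lemma card_le_powerset (T U : pointedType) (A : set T) (B : set U) :
  A #<= B -> [set X : set T | X `<=` A] #<= [set X : set U | X `<=` B].
Proof.
move=> /card_le_surjP[f AfB].
apply: (card_le_inj (f := fun X => B `&` f @^-1` X)).
  by move=> X _ b [].
move=> X Y XA YA /seteqP[XY YX]; apply/seteqP; split=> t Xt.
  have [b Bb bt] := AfB _ (XA _ Xt); rewrite -bt in Xt *.
  by have [] : (B `&` f @^-1` Y) b by apply: XY; split.
have [b Bb bt] := AfB _ (YA _ Xt); rewrite -bt in Xt *.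
by have [] : (B `&` f @^-1` X) b by apply: YX; split.
Qed.

Lemma strong_limit_powerset (T : pointedType) (A : set T) k :
  strong_limit k -> size_lt A k -> size_lt [set X : set T | X `<=` A] k.
Proof.
move=> ks /size_ltP[a ak Aa]; apply: size_lt_le (ks a ak).
exact: card_le_powerset.
Qed.

Lemma size_lt_setU (T : pointedType) (A B : set T) rho :
  omega < cof rho -> size_lt A rho -> size_lt B rho -> size_lt (A `|` B) rho.
Proof.
move=> oc Ar Br.
have -> : A `|` B = \bigcup_(b in [set: bool]) (if b then A else B).
  apply/seteqP; split=> [t [At|Bt]|t [[] _ /= h]]; first by exists true.
  - by exists false.
  - by left.
  - by right.
apply: size_lt_bigcup.
- exact: lt_le_trans oc (cof_le _).
- apply: finite_size_lt (ltW oc) _; exact: finite_finset.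
- by case.
Qed.

Lemma chain_union_size_lt rho (a : Ord) (s : Ord -> set Ord) (X : set Ord) :
  omega < cof rho -> a < cof rho ->
  (forall b, b < a -> Psub rho X (s b)) ->
  Psub rho X (\bigcup_(b in seg a) s b).
Proof.
move=> oc ac sP; split; first by move=> i [b /sP[+ _]]; exact.
apply: size_lt_bigcup.
- exact: lt_le_trans oc (cof_le _).
- by exists a => //; exact: card_eqxx.
- by move=> b /sP[].
Qed.

(** * Clubs of closed sets, and restrictions of functions to 2 *)

(** A set becomes closed after countably many steps, which keeps its size
    below [rho]; in a chain, any two elements already lie in a common member.
    *)
Lemma closed_under_club rho (X : set Ord) (c : Ord -> Ord -> Ord) :
  omega < cof rho -> (forall a b, X a -> X b -> X (c a b)) ->
  club rho X [set x | Psub rho X x /\ forall a b, x a -> x b -> x (c a b)].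
Proof.
move=> oc cX; have orho : omega < rho by exact: lt_le_trans oc (cof_le _).
split; first by move=> x [].
- move=> x xP.
  pose step y := y `|` (fun p => c p.1 p.2) @` (y `*` y).
  pose y n := iter n step x.
  have ymono n m : (n <= m)%N -> y n `<=` y m.
    move=> /subnK <-; elim: (m - n)%N => // k IH a /IH h.
    by rewrite addSn /y iterS; left.
  have yP n : Psub rho X (y n).
    elim: n => // n [ynX yns]; split.
      move=> _ [/ynX//|[[a b] [/= /ynX Xa /ynX Xb] <-]]; exact: cX.
    by apply: size_lt_setU => //; apply: size_lt_image; exact: size_lt_setX.
  exists (\bigcup_n y n); last by move=> a xa; exists 0%N.
  split; first split.
  + by move=> a [n _ /(yP n).1].
  + apply: size_lt_bigcup => //; first exact: size_lt_nat.
    by move=> n _; exact: (yP n).2.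
  + move=> a b [n _ na] [m _ mb]; exists (maxn n m).+1 => //.
    rewrite /y iterS; right; exists (a, b) => //; split => /=.
      exact: ymono (leq_maxl _ _) _ na.
    exact: ymono (leq_maxr _ _) _ mb.
- move=> a s _ ac sE smono; split.
    by apply: chain_union_size_lt => // b /sE[].
  move=> i j [b ba ib] [d da jd]; case: (leP b d) => [bd|/ltW db].
    by exists d => //; apply: (sE d da).2 => //; exact: smono ib.
  by exists b => //; apply: (sE b ba).2 => //; exact: smono jd.
Qed.

Lemma restrT (f : pfun2) (x : set Ord) a : x a -> restr f x a = f a.
Proof. by move=> xa; rewrite /restr patchE mem_set. Qed.

Lemma restrN (f : pfun2) (x : set Ord) a : ~ x a -> restr f x a = None.
Proof. by move=> xa; rewrite /restr patchE memNset. Qed.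

Lemma dom_restr (f : pfun2) (x : set Ord) : dom (restr f x) = x `&` dom f.
Proof.
apply/seteqP; split=> a; rewrite /dom /=.
  by have [xa|xa] := pselect (x a); rewrite ?(restrT _ xa)// restrN.
by move=> [xa]; rewrite restrT.
Qed.

Lemma restr_restr (f : pfun2) (x y : set Ord) :
  x `<=` y -> restr (restr f y) x = restr f x.
Proof.
move=> xy; apply/funext => a; have [xa|xa] := pselect (x a).
  by rewrite !restrT//; exact: xy.
by rewrite !restrN.
Qed.

(** * From branches meeting ladders to normal measures *)

Section LadderToMeasure.
Variables kappa lambda mu : Ord.
Hypothesis kappa_inacc : inaccessible kappa.
Hypothesis lambda_card : is_cardinal lambda.
Hypothesis kappa_lambda : kappa <= lambda.
Hypothesis lambda_mu : lambda <= mu.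
Let P := Psub kappa (seg lambda).

(** Enumerations of the subsets of P_kappa lambda and of the functions from
    P_kappa lambda to [lambda], by ordinals below [mu]. *)
Variables (A : Ord -> set (set Ord)) (f : Ord -> set Ord -> Ord).
(** Codes are only compared on P_kappa lambda, where the measure will be
    concentrated. *)
Definition codes g (X : set (set Ord)) :=
  g < mu /\ forall s, P s -> (A g s <-> X s).
Hypothesis A_surj : forall X, exists g, codes g X.
Hypothesis f_surj : forall F : set Ord -> Ord,
  (forall s, P s -> F s < lambda) ->
  exists2 g, g < mu & forall s, P s -> f g s = F s.

Let kappa_cof : cof kappa = kappa.
Proof. by case: kappa_inacc => -[]. Qed.

Let omega_cof : omega < cof kappa.
Proof. by rewrite kappa_cof; case: kappa_inacc. Qed.

Let omega_kappa : omega < kappa.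
Proof. by case: kappa_inacc. Qed.

Let strong : strong_limit kappa.
Proof. by case: kappa_inacc. Qed.

Definition mem_fun (s : set Ord) : pfun2 := fun a => Some `[< A a s >].

(** Requiring [s] to contain all ordinals of [x] below [lambda] is what will
    make the measure fine. *)
Definition mem_tree (x : set Ord) : set pfun2 :=
  [set restr (mem_fun s) x | s in [set s | P s /\ x `&` seg lambda `<=` s]].

(** A measure that contains both this set and the set of [s] with [f b s] in
    [s] makes the function with code [b] constant with value [a]. *)
Definition pinned (b a : Ord) : set (set Ord) :=
  [set s | s (f b s) -> f b s = a].

(** Only the code [g] has to lie in the domain of [h], not the value [a].
    Choosing one [g] for each [b] is therefore a unary operation on the
    domain, and [h] stays normal on every set closed under it. *)
Definition normal_at (h : pfun2) : Prop := forall b, dom h b ->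
  exists g, h g = Some true /\ exists a, codes g (pinned b a).

Definition normal_ladder : set pfun2 :=
  [set h | normal_at h /\ exists2 x, Psub kappa (seg mu) x & mem_tree x h].

Lemma dom_mem_fun s x : dom (restr (mem_fun s) x) = x.
Proof. by rewrite dom_restr; apply/seteqP; split=> [a []|a]. Qed.

Lemma mem_tree_dom x h : mem_tree x h -> dom h = x.
Proof. by move=> [s _ <-]; exact: dom_mem_fun. Qed.

Lemma mem_tree_ex x : Psub kappa (seg mu) x ->
  mem_tree x (restr (mem_fun (x `&` seg lambda)) x).
Proof.
move=> [xm xk]; exists (x `&` seg lambda) => //; split=> //; split.
  exact: subIsetr.
exact: size_lt_sub xk.
Qed.

Lemma mem_tree_restr x y h :
  x `<=` y -> mem_tree y h -> mem_tree x (restr h x).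
Proof.
move=> xy [s [sP ys] <-]; exists s; last by rewrite restr_restr.
by split=> // a [/xy ya la]; exact: ys.
Qed.

Lemma mem_Ptree : Ptree kappa mu mem_tree.
Proof.
split.
- move=> x xP; split; last by move=> h /mem_tree_dom.
  by exists (restr (mem_fun (x `&` seg lambda)) x); exact: mem_tree_ex.
- by move=> x y h _ _; exact: mem_tree_restr.
- move=> x [_ xk]; apply: size_lt_le (strong_limit_powerset strong xk).
  apply: (card_le_surj (f := fun X => restr (fun a => Some `[< X a >]) x)).
  move=> _ [s _ <-]; exists (x `&` [set a | A a s]); first exact: subIsetl.
  apply/funext => a; have [xa|xa] := pselect (x a).
    by rewrite !restrT// /mem_fun; congr Some; apply: asbool_equiv_eq; split=> [[]|].
  by rewrite !restrN.
Qed.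

(** At a set [x] closed under coding, the node of the point [s] made of the
    elements of [x] below [lambda] is normal: a value [f b s] in [s] is itself
    an element of [x], so the code of the set pinning it belongs to [x]. *)
Lemma normal_ladder_system : ladder_system kappa mu mem_tree normal_ladder.
Proof.
split.
- by move=> h [_ [x xP xh]]; exists x.
- have /choice[c cP] : forall p : Ord * Ord, exists g, codes g (pinned p.1 p.2).
    by move=> p; exact: A_surj.
  exists [set x | Psub kappa (seg mu) x /\
                  forall a b, x a -> x b -> x (c (a, b))].
    by apply: (closed_under_club (c := fun a b => c (a, b))) => // a b _ _; apply: (cP _).1.
  move=> x [xP xc]; exists (restr (mem_fun (x `&` seg lambda)) x).
  have tx := mem_tree_ex xP.
  split=> //; split; last by exists x.
  set s := x `&` seg lambda; have sP : P s.
    by split; [exact: subIsetr | exact: size_lt_sub (@subIsetl _ _ _) xP.2].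
  move=> b; rewrite dom_mem_fun => xb.
  (* If [f b s] is not in [s], then [s] is in [pinned b a] for any [a]; the
     code [b] is an element of [x] at hand. *)
  have [sf|nsf] := pselect (s (f b s)).
    exists (c (b, f b s)); split; last by exists (f b s); exact: cP.
    rewrite restrT; last by apply: xc => //; exact: sf.1.
    by congr Some; apply/asboolP; apply/(cP _).2.
  exists (c (b, b)); split; last by exists b; exact: cP.
  rewrite restrT; last exact: xc.
  by congr Some; apply/asboolP; apply/(cP _).2.
- move=> x h xP [[hn _] xh] orho; have hdom := mem_tree_dom xh.
  have /choice[w wP] : forall b, exists g, x b ->
      h g = Some true /\ exists a, codes g (pinned b a).
    move=> b; have [xb|] := pselect (x b); last by exists point.
    by have [|g hg] := hn b; [rewrite hdom | exists g].
  have wx b : x b -> x (w b) by move=> /wP[hw _]; rewrite -hdom /dom/= hw.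
  exists [set y | Psub (cardinality (x `&` seg kappa)) x y /\
                  forall a b, y a -> y b -> y (w a)].
    by apply: (closed_under_club (c := fun a _ => w a)) => // a b xa _; exact: wx.
  move=> _ [y [[yx _] yw] <-]; split.
    move=> b; rewrite dom_restr => -[yb _]; have [hw ?] := wP b (yx b yb).
    by exists (w b); split=> //; rewrite restrT//; exact: (yw b b).
  exists y; last exact: mem_tree_restr xh.
  by split; [exact: subset_trans yx xP.1 | exact: size_lt_sub yx xP.2].
Qed.

Variable b : pfun2.
Hypothesis b_branch : branch kappa mu mem_tree b.
Hypothesis b_meets : meets_cofinally kappa mu normal_ladder b.

Definition branch_measure : set (set (set Ord)) :=
  [set X | exists2 g, codes g X & b g = Some true].
Let U := branch_measure.

Lemma branch_witness x : Psub kappa (seg mu) x -> exists s,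
  [/\ P s, x `&` seg lambda `<=` s & forall a, x a -> b a = Some `[< A a s >]].
Proof.
move=> xP; have [s [sP xs] bs] := b_branch.2 x xP; exists s; split=> // a xa.
by rewrite -(restrT b xa) -bs restrT.
Qed.

(** Below [kappa] many sets are decided simultaneously by the membership of
    one point [s]. The ultrafilter laws and completeness follow by applying
    this to the sets involved. *)
Lemma measure_witness (XX : set (set (set Ord))) : size_lt XX kappa ->
  exists2 s, P s & forall X, XX X -> (U X <-> X s).
Proof.
move=> XXk; have /choice[g gP] := A_surj.
pose x0 := g @` XX.
have x0P : Psub kappa (seg mu) x0.
  by split; [move=> _ [X _ <-]; exact: (gP X).1 | exact: size_lt_image].
have [s [sP _ bs]] := branch_witness x0P; exists s => // X XX_X.
have bg : b (g X) = Some `[< X s >].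
  by rewrite bs; [congr Some; exact: asbool_equiv_eq ((gP X).2 s sP)|exists X].
split=> [[g' g'P bg']|Xs]; last by exists (g X) => //; rewrite bg; congr Some; apply/asboolP.
have [|t [tP _ bt]] := @branch_witness [set g X; g'].
  split; first by move=> _ [->|->]; [exact: (gP X).1|exact: g'P.1].
  by apply: finite_size_lt (ltW omega_kappa) _; exact: finite_set2.
have := bt g'; rewrite bg' => /(_ (or_intror erefl))[] /esym/asboolP/(g'P.2 _ tP)/((gP X).2 _ tP) At.
have := bt (g X); rewrite bg => /(_ (or_introl erefl))[] e.
by apply/asboolP; rewrite e; apply/asboolP.
Qed.

Let fin_witness (XX : set (set (set Ord))) : finite_set XX ->
  exists2 s, P s & forall X, XX X -> (U X <-> X s).
Proof. by move=> fX; apply: measure_witness; apply: finite_size_lt fX; exact: ltW. Qed.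

Lemma measure_ultra : UltraFilter U.
Proof.
have Uproper : ProperFilter U.
  split=> [U0|].
    have [|s _ sU] := @fin_witness [set set0]; first exact: finite_set1.
    exact: (sU set0 erefl).1 U0.
  split.
  - have [|s _ sU] := @fin_witness [set setT]; first exact: finite_set1.
    by apply/sU.
  - move=> X Y UX UY.
    have [|s _ sU] := @fin_witness [set X; Y; X `&` Y]; first exact: finite_set3.
    apply/sU; first by right.
    by split; apply/sU => //; left; [left|right].
  - move=> X Y XY UX.
    have [|s _ sU] := @fin_witness [set X; Y]; first exact: finite_set2.
    by apply/sU; [right|apply: XY; apply/sU => //; left].
split=> // G Gp UG; apply/seteqP; split=> // X GX.
have [|s _ sU] := @fin_witness [set X; ~` X]; first exact: finite_set2.
have [Xs|nXs] := pselect (X s); first exact: (sU _ (or_introl erefl)).2 Xs.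
have /UG GnX : U (~` X) by exact: (sU _ (or_intror erefl)).2 nXs.
have GX0 : G (X `&` ~` X) by exact: filterI.
by exfalso; apply: (filter_not_empty G); rewrite -(setICr X).
Qed.

Lemma measure_fine : is_fine lambda U.
Proof.
move=> a al; have [g gP] := A_surj [set x | x a]; exists g => //.
have [|s [sP xs bs]] := @branch_witness [set g; a].
  split; first by move=> _ [->|->]; [exact: gP.1|exact: lt_le_trans lambda_mu].
  by apply: finite_size_lt (ltW omega_kappa) _; exact: finite_set2.
rewrite bs; last by left.
by congr Some; apply/asboolP/gP.2 => //; apply: xs; split=> //; right.
Qed.

Lemma measure_Psub : U P.
Proof.
have [|s sP sU] := @fin_witness [set P]; first exact: finite_set1.
by apply/sU.
Qed.

Lemma measure_is_measure : is_measure kappa lambda U.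
Proof.
have UU := measure_ultra; split=> //; first exact: measure_Psub.
- move=> x Ux.
  have xP : P x by have [y [-> ]] := filter_ex (filterI Ux measure_Psub).
  have [[a al nxa]|nex] := pselect (exists2 a, a < lambda & ~ x a).
    by have [_ [-> /nxa]] := filter_ex (filterI Ux (measure_fine al)).
  case: xP => _ [a ak ax]; apply: (cardinal_Nle lambda_card (lt_le_trans ak kappa_lambda)).
  rewrite card_eq_sym in ax; apply: card_le_trans (eq_card_le ax).
  by apply: subset_card_le => c cl; apply: contrapT => nxc; apply: nex; exists c.
- move=> a X ak UX; pose I := [set x | forall c, c < a -> X c x].
  have [|s sP sU] := @measure_witness ((X @` seg a) `|` [set I]).
    apply: size_lt_setU => //.
      by apply: size_lt_image; exists a => //; exact: card_eqxx.
    by apply: finite_size_lt (ltW omega_kappa) _; exact: finite_set1.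
  apply/sU; first by right.
  by move=> c ca; apply/sU; [left; exists c | exact: UX].
Qed.

(** If [F] is regressive on a measure one set, a restriction of the branch in
    the ladder whose domain contains a code of [F] decides some set pinning
    [F]. *)
Lemma measure_normal : is_normal kappa lambda U.
Proof.
have UU := measure_ultra.
move=> F Fl UF; have [g gm gF] := f_surj Fl.
have [|z [zP gz [zn _]]] := b_meets (x := [set g]).
  split=> [_ -> //|].
  by apply: finite_size_lt (ltW omega_kappa) _; exact: finite_set1.
have [|g' [zg' [a g'P]]] := zn g.
  rewrite dom_restr; split; first exact: gz.
  by rewrite (b_branch.1 : dom b = _).
have zg : z g' by apply: contrapT => /(restrN b); rewrite zg'.
have Upinned : U (pinned g a) by exists g' => //; rewrite -(restrT b zg).
have UFa : U ([set x | x (F x)] `&` pinned g a `&` P).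
  by apply: filterI measure_Psub; exact: filterI.
have key x : ([set x | x (F x)] `&` pinned g a `&` P) x -> F x = a /\ P x.
  by move=> [[xF xfr] xP]; split=> //; rewrite -gF//; apply: xfr; rewrite gF.
exists a; last by apply: filterS UFa => x /key[].
by have [x /key[<- xP]] := filter_ex UFa; exact: Fl.
Qed.

End LadderToMeasure.

(** Functions on a small set are coded by functions between the covering
    types; outside [D] a value has to be prescribed. *)
Lemma small_functions T (V : pointedType) (D : set T) (Q : set V) :
  small_set D -> small_set Q ->
  small_set [set F : T -> V | forall s, (D s -> Q (F s)) /\ (~ D s -> F s = point)].
Proof.
move=> [C [G DG]] [C' [G' QG']].
have /choice[e eP] : forall s, exists oc, D s -> omap G oc = Some s.
  move=> s; have [/DG[c _ cs]|] := pselect (D s); last by exists None.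
  by exists (Some c) => /=; rewrite cs.
exists (C -> option C'), (fun h s => if pselect (D s) is left _ then
  oapp G' point (obind h (e s)) else point) => F FP.
have /choice[h hP] : forall c, exists oc, D (G c) -> oapp G' point oc = F (G c).
  move=> c; have [Dc|] := pselect (D (G c)); last by exists None.
  by have [c' _ c'E] := QG' _ ((FP (G c)).1 Dc); exists (Some c').
exists h => //; apply/funext => s; case: pselect => [Ds|/((FP s).2) ->//].
by have := eP s Ds; case: (e s) => //= c [cs]; rewrite hP cs.
Qed.

(** Unboundedness of the regular cardinals provides one that is large enough
    for both families of codes. *)
Lemma LSCP_supercompact kappa : inaccessible kappa ->
  (forall mu : Ord, regular_cardinal mu -> kappa <= mu -> LSCP_cofinally kappa mu) ->
  supercompact kappa.
Proof.
move=> kinacc lscp lambda lcard kl.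
pose P := Psub kappa (seg lambda).
have Ps : small_set P.
  by apply: small_sub (small_powerset (small_seg lambda)) => x [].
have [a1 a1P] := small_card_seg (small_powerset Ps).
have [a2 a2P] := small_card_seg (small_functions Ps (small_seg lambda)).
have [mu mureg mlt] := regular_unbounded (Order.max lambda (Order.max a1 a2)).
move: mlt; rewrite !gt_max => /and3P[lm a1m a2m].
rewrite card_eq_sym in a1P; have [A AP] := card_le_surjP (eq_card_le a1P).
rewrite card_eq_sym in a2P; have [f fP] := card_le_surjP (eq_card_le a2P).
have A_surj X : exists g, codes kappa lambda mu A g X.
  have [|g ga gX] := AP (X `&` P); first exact: subIsetr.
  by exists g; split=> [|s Ps']; [exact: lt_trans a1m | rewrite gX; split=> [[]|]].
have f_surj F : (forall s, P s -> F s < lambda) ->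
    exists2 g, g < mu & forall s, P s -> f g s = F s.
  move=> Fl; have [|g ga gF] := fP (fun s => if pselect (P s) is left _ then F s else point).
    by move=> s; split=> h; case: pselect => // h'; exact: Fl.
  exists g; first exact: lt_trans a2m.
  by move=> s sP; rewrite gF; case: pselect.
have km : kappa <= mu by exact: le_trans kl (ltW lm).
have lm' := ltW lm.
have [b bB bM] := lscp mu mureg km _ _ (mem_Ptree lambda mu kinacc A)
  (normal_ladder_system kinacc f A_surj).
exists (branch_measure kappa lambda mu A b); split.
- exact: measure_is_measure bB.
- exact: measure_fine bB.
- exact: measure_normal bM.
Qed.

(** * Unions of chains in a club *)

Lemma image_enum (T : pointedType) (D : set T) a :
  seg a #= D -> exists g : Ord -> T, D = g @` seg a.
Proof.
move=> /card_set_bijP[g [gf _ gs]]; exists g; apply/seteqP; split=> [|_ [c ca <-]]; [exact: gs|exact: gf].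
Qed.

(** An infinite cardinal is a limit ordinal, so finitely many indices have a
    common strict upper bound below it. *)
Lemma finite_in_initial k (g : Ord -> Ord) (e : set Ord) :
  is_cardinal k -> omega <= k -> finite_set e -> e `<=` g @` seg k ->
  exists2 i, i < k & e `<=` g @` seg i.
Proof.
move=> kc ok /finite_seqP[s ->]; elim: s => [_|t s IH sub].
  have [i ki] := infinite_setN0 ((infinite_seg k).2 ok).
  by exists i => // t.
have [|i ik is_] := IH.
  by move=> u us; apply: sub; rewrite /= inE us orbT.
have [|j jk gj] := sub t; first by rewrite /= inE eqxx.
have [l ml lk] : exists2 l, Order.max i j < l & l < k.
  by apply: infinite_cardinal_limit; rewrite // gt_max; apply/andP.
move: ml; rewrite gt_max => /andP[il jl].
exists l => // u /=; rewrite inE => /orP[/eqP ->|us]; first by exists j.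
by have [m mi <-] := is_ _ us; exists m => //; exact: lt_trans il.
Qed.

(** Clubs are closed under unions of chains indexed by ordinals; the countable
    chain is reindexed along the ordinals below omega, each of which has a
    finite size. *)
Lemma club_nat_union rho X E (s : nat -> set Ord) :
  club rho X E -> omega < cof rho -> (forall n, E (s n)) ->
  (forall n, s n `<=` s n.+1) -> E (\bigcup_n s n).
Proof.
move=> [_ _ Ecl] oc sE smono.
have mono n m : (n <= m)%N -> s n `<=` s m.
  move=> /subnK <-; elim: (m - n)%N => // k IH; rewrite addSn.
  exact: subset_trans IH _.
(* For b = n below omega this is s n, as the chain is increasing. *)
pose s' b := \bigcup_(n in [set n | `I_n #<= seg b]) s n.
have -> : \bigcup_n s n = \bigcup_(b in seg omega) s' b.
  apply/seteqP; split=> [a [n _ na]|a [b _ [n _ na]]]; last by exists n.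
  have [|b bo bn] := @card_le_seg _ `I_n omega.
    apply: card_le_trans ((infiniteP _).1 seg_omega).
    exact: card_leT.
  exists b; last by exists n => //=; rewrite card_eq_sym in bn; exact: eq_card_le.
  by apply/finite_seg; exists n.
apply: Ecl => //.
- exact: infinite_setN0 seg_omega.
- move=> b /finite_seg[N bN]; suff -> : s' b = s N by [].
  apply/seteqP; split=> [a [n /= nb]|a Na].
    by apply: mono; move: nb; rewrite (card_le_eqr bN) card_le_II.
  by exists N => //=; rewrite card_eq_sym in bN; exact: eq_card_le.
- move=> b c bc _ a [n /= nb na]; exists n => //=.
  exact: card_le_trans nb (subset_card_seg bc).
Qed.

(** * From normal measures to branches meeting ladders *)

Section MeasureToLadder.
Variables (kappa mu : Ord) (U : set (set (set Ord))).
Hypothesis kappa_inacc : inaccessible kappa.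
Hypothesis kappa_mu : kappa <= mu.
Hypothesis U_measure : is_measure kappa mu U.
Hypothesis U_fine : is_fine mu U.
Hypothesis U_normal : is_normal kappa mu U.
Let P := Psub kappa (seg mu).
Let rho (x : set Ord) := cardinality (x `&` seg kappa).

Let U_ultra : UltraFilter U.
Proof. by case: U_measure. Qed.

Let U_filter : Filter U.
Proof. by case: (@ultra_proper _ _ U_ultra). Qed.

#[local] Existing Instance U_ultra.
#[local] Existing Instance U_filter.

Let U_P : U P.
Proof. by case: U_measure. Qed.

Let kappa_cof : cof kappa = kappa.
Proof. by case: kappa_inacc => -[]. Qed.

Let omega_kappa : omega < kappa.
Proof. by case: kappa_inacc. Qed.

Let omega_cof : omega < cof kappa.
Proof. by rewrite kappa_cof. Qed.

Let strong : strong_limit kappa.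
Proof. by case: kappa_inacc. Qed.

Lemma ae_not (Q : set Ord -> Prop) :
  ~ U [set x | Q x] -> U [set x | ~ Q x].
Proof. by have [|] := in_ultra_setVsetC [set x | Q x] U_ultra. Qed.

Lemma ae_forall (I : pointedType) (J : set I) (Q : I -> set Ord -> Prop) :
  size_lt J kappa -> (forall i, J i -> U [set x | Q i x]) ->
  U [set x | forall i, J i -> Q i x].
Proof.
move=> [a ak /image_enum[e ->]] JQ.
have [_ _ _ /(_ a (fun b => [set x | Q (e b) x]) ak)] := U_measure.
move=> /(_ (fun b ba => JQ _ (ex_intro2 _ _ b ba erefl))).
by apply: filterS => x Qx _ [b ba <-]; exact: Qx.
Qed.

(** Normality for relations: choose a witness in [x] wherever there is one. *)
Lemma ae_const (Q : set Ord -> Ord -> Prop) :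
  U [set x | exists2 a, x a & Q x a] -> exists2 a, a < mu & U [set x | Q x a].
Proof.
move=> UQ; pose F x := if pselect (exists2 a, x a & P x /\ Q x a) is left h
  then s2val (cid2 h) else omega.
have [x xP||a am aF] := U_normal (f := F).
- rewrite /F; case: pselect => [h|_]; last exact: lt_le_trans kappa_mu.
  by case: cid2 => a /= xa [[xm _] _]; exact: xm.
- apply: filterS2 U_P UQ => x xP [a xa Qa]; rewrite /= /F.
  by case: pselect => [h|[]]; [case: cid2|exists a].
exists a => //; apply: filterS3 U_P UQ aF => x xP [c xc Qc].
by rewrite /= /F; case: pselect => [h|[]]; [case: cid2 => d /= _ [_ ?] <-|exists c].
Qed.

Lemma ae_const_fun d (G : set Ord -> Ord -> Ord) : d < kappa ->
  U [set x | forall i, i < d -> x (G x i)] ->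
  exists h, U [set x | forall i, i < d -> G x i = h i].
Proof.
move=> dk UG.
have /choice[h hP] : forall i, exists a, i < d -> U [set x | G x i = a].
  move=> i; have [id_|] := pselect (i < d); last by exists point.
  have [|a _ aP] := @ae_const (fun x a => G x i = a); last by exists a.
  by apply: filterS UG => x xG; exists (G x i) => //; exact: xG.
exists h; apply: (@ae_forall _ (seg d) (fun i x => G x i = h i)) => //.
by exists d => //; exact: card_eqxx.
Qed.

Lemma ae_subset y : P y -> U [set x | y `<=` x].
Proof.
move=> [ym yk]; apply: (@ae_forall _ y (fun a x => x a)) => // a /ym.
exact: U_fine.
Qed.

Lemma seg_P a : a < kappa -> P (seg a).
Proof.
move=> ak; split; last by exists a => //; exact: card_eqxx.
by move=> c /lt_trans; apply; exact: lt_le_trans kappa_mu.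
Qed.

(** Otherwise some element of [x] below [kappa] with a smaller ordinal missing
    from [x] would be almost everywhere the same ordinal [a], while almost
    every [x] contains all ordinals below [a]. *)
Lemma ae_initial : U [set x | forall a b, x a -> a < kappa -> b < a -> x b].
Proof.
apply: contrapT => /ae_not nU.
have [|a _ aQ] := @ae_const (fun x a => a < kappa /\ exists2 b, b < a & ~ x b).
  apply: filterS nU => x /existsNP[a /existsNP[b /not_implyP[xa /not_implyP[ak]]]].
  by move=> /not_implyP[ba nxb]; exists a => //; split=> //; exists b.
have [x [ak _]] := filter_ex aQ.
have [y [[_ [b ba nyb]] ysub]] := filter_ex (filterI aQ (ae_subset (seg_P ak))).
exact/nyb/ysub.
Qed.

Lemma small_core x : small_set (x `&` seg kappa).
Proof. exact: small_sub (@subIsetr _ _ _) (small_seg kappa). Qed.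

Lemma ae_core_sub : U [set x | seg (rho x) `<=` x `&` seg kappa].
Proof.
apply: filterS ae_initial => x xinit c cr; apply: contrapT => nxc.
suff : rho x <= c by rewrite leNgt => /negP; apply.
apply: cardinality_le; apply: subset_card_le => a [xa ak].
rewrite /seg /= ltNge; apply/negP; rewrite le_eqVlt => /orP[/eqP ca|ca].
  by apply: nxc; rewrite ca.
by apply: nxc; split; [exact: (xinit a)|exact: lt_trans ak].
Qed.

(** As [kappa] is a strong limit, almost every [x] includes an initial segment
    of [kappa] of the size of the power set of [g]. *)
Lemma ae_core_gt g : g < kappa -> U [set x | g < rho x].
Proof.
move=> /strong[g' g'k g'P].
apply: filterS (ae_subset (seg_P g'k)) => x sub; rewrite /= ltNge.
apply/negP => rg; rewrite card_eq_sym in g'P.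
apply: (@cantor _ (seg g) _ (seg g)); last exact: card_lexx.
apply: card_le_trans (eq_card_le g'P) _; apply: card_le_trans (subset_card_seg rg).
have := cardinalityP (small_core x); rewrite card_eq_sym => /eq_card_le.
apply: card_le_trans; apply: subset_card_le => c cg; split; first exact: sub.
exact: lt_trans g'k.
Qed.

(** Otherwise almost every [rho x] would have a cofinal map of the same
    countable length [d]. By normality its values would be almost everywhere
    the same ordinals below [kappa], hence bounded by a fixed [c] below
    [kappa], while [rho x] exceeds [c] almost everywhere. *)
Lemma ae_core_cof : U [set x | omega < cof (rho x)].
Proof.
apply: contrapT => /ae_not nU.
pose cofinal x d (f : Ord -> Ord) := (forall i, i < d -> f i < rho x) /\
  (forall c, c < rho x -> exists2 i, i < d & c <= f i).
have [|d _ dP] := @ae_const (fun x d => d <= omega /\ exists f, cofinal x d f).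
  apply: filterS3 nU ae_core_sub (ae_core_gt omega_kappa) => x /negP.
  rewrite -leNgt => co rx orx; exists (cof (rho x)).
    by apply: (rx _ _).1; exact: le_lt_trans orx.
  split=> //; have [|f f1 f2] := (leastP (A := [set b | exists2 f : Ord -> Ord,
    (forall d, d < b -> f d < rho x) &
    forall c, c < rho x -> exists2 d, d < b & c <= f d]) _).1.
    by exists (rho x); exact: cof_ex.
  by exists f.
have [x [dom _]] := filter_ex dP; have dk := le_lt_trans dom omega_kappa.
have /choice[f fP] : forall x, exists f, (exists f, cofinal x d f) -> cofinal x d f.
  move=> y; have [[f yf]|] := pselect (exists f, cofinal y d f); first by exists f.
  by exists id.
have fU : U [set x | forall i, i < d -> (x `&` seg kappa) (f x i)].
  apply: filterS2 dP ae_core_sub => y [_ /fP[fr _]] ry i /fr; exact: ry.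
have [|h hU] := @ae_const_fun d f dk.
  by apply: filterS fU => y fy i /fy[].
have hk i : i < d -> h i < kappa.
  move=> id_; have [y [fy hy]] := filter_ex (filterI fU hU).
  by rewrite -(hy i id_); exact: (fy i id_).2.
have [|c ck hc] := @cof_bound _ (seg d) h kappa _ hk.
  by exists d; [rewrite kappa_cof|exact: card_eqxx].
have Ufin : U ([set x | d <= omega /\ exists f, cofinal x d f] `&`
   ([set x | forall i, i < d -> f x i = h i] `&` [set x | c < rho x])).
  by apply: filterI => //; apply: filterI => //; exact: ae_core_gt.
have [y [[_ /fP[_ cofy]] [fy cy]]] := filter_ex Ufin.
have [i id_] := cofy c cy; rewrite fy// => ci.
by have := hc i id_; rewrite ltNge ci.
Qed.

(** Normality for small subsets: the order type of the subset lies in [x], so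
    it may be assumed constant, and then so may each entry of an enumeration
    of that length. *)
Lemma ae_const_set (Q : set Ord -> set Ord -> Prop) :
  U [set x | exists z, [/\ z `<=` x, size_lt z (rho x) & Q x z]] ->
  exists2 z, P z & U [set x | Q x z].
Proof.
move=> UQ.
pose R x d g := (forall i, i < d -> x (g i)) /\ Q x (g @` seg d).
have [|d _ dP] := @ae_const (fun x d => d < kappa /\ exists g : Ord -> Ord, R x d g).
  apply: filterS2 UQ ae_core_sub => x [z [zx [d dr /image_enum[g zE]] Qz]] rx.
  have [xd dk] := rx d dr; exists d => //; split=> //; exists g; split.
    by move=> i id_; apply: zx; rewrite zE; exists i.
  by rewrite -zE.
have [_ [dk _]] := filter_ex dP.
have /choice[G GP] : forall x, exists g, (exists g, R x d g) -> R x d g.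
  move=> x; have [[g xg]|] := pselect (exists g, R x d g); first by exists g.
  by exists id.
have [|h hU] := @ae_const_fun d G dk.
  by apply: filterS dP => x [_ /GP[]].
have hG x : (forall i, i < d -> G x i = h i) -> G x @` seg d = h @` seg d.
  by move=> Gh; apply/seteqP; split=> _ [i id_ <-]; exists i => //; rewrite Gh.
exists (h @` seg d).
  split; last by apply: size_lt_image; exists d => //; exact: card_eqxx.
  move=> _ [i id_ <-].
  have U3 : U (P `&` ([set x | d < kappa /\ exists g : Ord -> Ord, R x d g] `&`
      [set x | forall i, i < d -> G x i = h i])).
    by do 2 apply: filterI => //.
  have [x [[xm _] [[_ /GP[Gx _]] Gh]]] := filter_ex U3.
  by apply: xm; rewrite -Gh//; exact: Gx.
apply: filterS2 dP hU => x [_ /GP[_ +]] /hG; by move=> + <-.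
Qed.

(** * Normal measures contain the clubs *)

Section Club.
Variable E : set (set Ord).
Hypothesis E_club : club kappa (seg mu) E.
Variable h : set Ord -> set Ord.
Hypothesis hE : forall x, P x -> E (h x) /\ x `<=` h x.

Let E_P x : E x -> P x.
Proof. by case: E_club => + _ _; exact. Qed.

(** The recursion makes the countable union [hull] monotone: each step at [e]
    absorbs the previous step at every subset of [e]. *)
Fixpoint hull_step (n : nat) (e : set Ord) : set Ord :=
  if n is m.+1 then h (e `|` \bigcup_(e' in [set e' | e' `<=` e]) hull_step m e')
  else h e.

Definition hull e := \bigcup_n hull_step n e.

Lemma Psub_subset (x y : set Ord) : x `<=` y -> P y -> P x.
Proof. by move=> xy [ym yk]; split; [exact: subset_trans ym|exact: size_lt_sub yk]. Qed.

Lemma hull_stepP n e : P e ->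
  [/\ E (hull_step n e), e `<=` hull_step n e &
      forall e', e' `<=` e -> hull_step n e' `<=` hull_step n.+1 e].
Proof.
have stepE : forall m, (forall e, P e -> E (hull_step m e)) -> forall e, P e ->
    P (e `|` \bigcup_(e' in [set e' | e' `<=` e]) hull_step m e').
  move=> m IH {}e eP; split.
    move=> a [/eP.1//|[e' e'e]].
    by have /IH/E_P[+ _] := Psub_subset e'e eP; exact.
  apply: size_lt_setU => //; first exact: eP.2.
  apply: size_lt_bigcup => //.
    rewrite kappa_cof; exact: strong_limit_powerset eP.2.
  by move=> e' e'e; have /IH/E_P[] := Psub_subset e'e eP.
have nE : forall m e, P e -> E (hull_step m e).
  elim=> [|m IH] {}e eP; first exact: (hE eP).1.
  exact: (hE (stepE m IH e eP)).1.
move=> eP; split; first exact: nE.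
  case: n => [|n]; first exact: (hE eP).2.
  by move=> a ea; apply: (hE (stepE n (nE n) e eP)).2; left.
by move=> e' e'e a ha; apply: (hE (stepE n (nE n) e eP)).2; right; exists e'.
Qed.

Lemma hull_E e : P e -> E (hull e).
Proof.
move=> eP; apply: (club_nat_union E_club) => // n.
  by have [] := hull_stepP n eP.
by have [_ _ ] := hull_stepP n eP; exact.
Qed.

Lemma hull_mono e e' : P e -> e' `<=` e -> hull e' `<=` hull e.
Proof.
move=> eP e'e a [n _ na]; exists n.+1 => //.
by have [_ _ /(_ _ e'e)] := hull_stepP n eP; exact.
Qed.

Lemma sub_hull e : P e -> e `<=` hull e.
Proof. by move=> eP a ea; exists 0%N => //; have [_ + _] := hull_stepP 0 eP; exact. Qed.

(** The union of a directed system of members of the club, which is finitary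
    in [x], unlike [hull]. *)
Definition fin_hull (x : set Ord) :=
  \bigcup_(e in [set e | finite_set e /\ e `<=` x]) hull e.

(** Clubs are only closed under unions of chains. By induction on the
    cardinality [d] of [x]: for finite [x] the union is the hull of [x]; for
    infinite [x] it is the union of the chain of the same construction applied
    to the first [i] elements of [x], for [i] below the limit ordinal [d]. *)
Lemma fin_hull_E x : P x -> E (fin_hull x).
Proof.
move: {2}(cardinality x) (erefl (cardinality x)) => d.
elim: (ord_lt_wf d) x => {}d _ IH x xd xP.
have xsmall : small_set x by exact: small_sub xP.1 (small_seg mu).
have dx := cardinalityP xsmall; rewrite xd in dx.
have [fx|nfx] := pselect (finite_set x).
  suff -> : fin_hull x = hull x by exact: hull_E.
  apply/seteqP; split=> [a [e [_ ex]]|a ha]; first exact: hull_mono.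
  by exists x => //; split.
have dc : is_cardinal d by rewrite -xd; exact: cardinality_is_cardinal.
have od : omega <= d by apply/infinite_seg; rewrite (eq_finite_set dx).
have dk : d < kappa.
  by case: xP => _ [c ck cx]; apply: le_lt_trans ck; rewrite -xd;
    apply: cardinality_le; apply: eq_card_le; rewrite card_eq_sym.
have [g xE] := image_enum dx.
have -> : fin_hull x = \bigcup_(i in seg d) fin_hull (g @` seg i).
  apply/seteqP; split=> a.
    move=> [e [fe]]; rewrite {1}xE => /(finite_in_initial dc od fe)[i id_ ei] ha.
    by exists i => //; exists e.
  move=> [i id_ [e [fe ei] ha]]; exists e => //; split=> //; rewrite xE.
  by apply: subset_trans ei _; apply: image_subset => c /lt_trans; exact.
have gmono i j : i <= j -> g @` seg i `<=` g @` seg j.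
  by move=> ij; apply: image_subset => c /lt_le_trans; exact.
case: E_club => _ _; apply.
- exact: infinite_setN0 ((infinite_seg d).2 od).
- by rewrite kappa_cof.
- move=> i id_; apply: (IH (cardinality (g @` seg i))) => //.
    apply: le_lt_trans id_; apply: cardinality_le; exact: card_image_le.
  by apply: Psub_subset xP; rewrite xE; exact/gmono/ltW.
- move=> i j ij _ a [e [fe ei] ha]; exists e => //; split=> //.
  exact: subset_trans (gmono _ _ ij).
Qed.

(** A finite subset of [x] whose hull escapes [x] would by normality be almost
    everywhere the same set [e], whose hull is a fixed member of P_kappa mu.
    *)
Lemma ae_hull_closed :
  U [set x | forall e, finite_set e -> e `<=` x -> hull e `<=` x].
Proof.
apply: contrapT => /ae_not nU.
have [|e eP eU] := @ae_const_set (fun x e => ~ (hull e `<=` x)).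
  apply: filterS2 nU (ae_core_gt omega_kappa) => x.
  move=> /existsNP[e /not_implyP[fe /not_implyP[ex nh]]] orx.
  by exists e; split=> //; exact: finite_size_lt (ltW orx) fe.
have [x [nh]] := filter_ex (filterI eU (ae_subset (E_P (hull_E eP)))).
exact.
Qed.

Lemma ae_club_hull : U E.
Proof.
apply: filterS2 U_P ae_hull_closed => x xP xc.
suff -> : x = fin_hull x by exact: fin_hull_E.
apply/seteqP; split=> [a xa|a [e [fe ex]]]; last exact: xc.
have ax : [set a] `<=` x by move=> _ ->.
exists [set a]; first by split=> //; exact: finite_set1.
by apply: sub_hull => //; exact: Psub_subset xP.
Qed.

End Club.

Lemma ae_club E : club kappa (seg mu) E -> U E.
Proof.
move=> Ec; have /choice[h hP] : forall x, exists y, P x -> E y /\ x `<=` y.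
  move=> x; have [|] := pselect (P x); last by exists point.
  by case: Ec => _ + _ => /[apply] -[y Ey xy]; exists y.
exact: ae_club_hull hP.
Qed.

(** * The branch as a limit along the measure *)

Lemma measure_LSCP : LSCP_cofinally kappa mu.
Proof.
move=> T L [T1 T2 _] [_ [E Ec EL] L3].
have /choice[eta etaP] : forall x, exists f, E x -> (L `&` T x) f.
  move=> x; have [/EL[f]|] := pselect (E x); first by exists f.
  by exists (fun=> None).
pose b : pfun2 := fun a =>
  if a < mu then Some `[< U [set x | eta x a = Some true] >] else None.
have UE := ae_club Ec.
have bU a : a < mu -> U [set x | eta x a = b a].
  move=> am; rewrite /b am; case: asboolP => [//|/ae_not nU].
  apply: filterS3 nU (filterI UE U_P) (U_fine am) => x nt [Ex xP] xa.
  have [_ /((T1 x xP).2) de] := etaP x Ex.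
  have : dom (eta x) a by rewrite de.
  by move: nt; rewrite /dom/=; case: (eta x a) => [[]|] // nt; case: nt.
have bUy y : P y -> U [set x | restr (eta x) y = restr b y].
  move=> [ym yk]; have := @ae_forall _ y (fun a x => eta x a = b a) yk.
  move=> /(_ (fun a ya => bU a (ym a ya))); apply: filterS => x xb.
  apply/funext => a; have [ya|ya] := pselect (y a).
    by rewrite !restrT//; exact: xb.
  by rewrite !restrN.
exists b.
  split.
    apply/seteqP; split=> a; rewrite /dom /b /seg /=; last by move=> ->.
    by case: ifP.
  move=> y yP.
  have Uy : U ((E `&` P) `&` ([set x | restr (eta x) y = restr b y] `&` [set x | y `<=` x])).
    by apply: filterI; apply: filterI => //; [exact: bUy|exact: ae_subset].
  have [x [[Ex xP] [<- yx]]] := filter_ex Uy.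
  by apply: (T2 y x) => //; exact: (etaP x Ex).2.
move=> y yP; case: (yP) => _ [d dk dy].
have [|z zP zU] := @ae_const_set (fun x z => y `<=` z /\ L (restr (eta x) z)).
  apply: filterS3 (filterI UE U_P) (filterI (ae_subset yP) (ae_core_gt dk)) ae_core_cof.
  move=> x [Ex xP] [yx dx] cx.
  have [E' [E'P E'cof _] E'L] := L3 x (eta x) xP (etaP x Ex) cx.
  have [|z E'z yz] := E'cof y; first by split=> //; exists d.
  have [zx zr] := E'P z E'z; exists z; split=> //; split=> //.
  by apply: E'L; exists z.
have [x [[yz Lz] xz]] := filter_ex (filterI zU (bUy z zP)).
by exists z; split=> //; rewrite -xz.
Qed.

End MeasureToLadder.

Theorem corollary20 (kappa : Ord) (kappa_inacc : inaccessible kappa) :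
  supercompact kappa <->
  (forall mu : Ord, regular_cardinal mu -> kappa <= mu ->
     LSCP_cofinally kappa mu).
Proof.
split=> [sc mu [muc _ _] km|]; last exact: LSCP_supercompact.
have [U [Um Uf Un]] := sc mu muc km.
exact: measure_LSCP Um Uf Un.
Qed.
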